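(* Let $G$ be a finite group, identified via an injective homomorphism with a subgroup of the symmetric group $S_k$ for some $k\in\mathbb{N}$. Let $\psi_{AB}$ be a pure bipartite state on $\mathcal{H}_A\otimes\mathcal{H}_B$ and let $\rho:=\operatorname{Tr}_A[\psi_{AB}]$. Let $p_G$ denote the acceptance probability, with respect to $G$, of the generalized bipartite pure-state separability algorithm. Then $$p_G=Z(G)(1,\operatorname{Tr}[\rho^2],\ldots,\operatorname{Tr}[\rho^k]),$$ that is, $p_G$ is the cycle index polynomial of $G$ (as a permutation group on $k$ letters) evaluated at $x_j=\operatorname{Tr}[\rho^j]$ for $j\in\{1,\ldots,k\}$.
   Context: $\mathcal{H}_A,\mathcal{H}_B$ are finite-dimensional complex Hilbert spaces; a pure state is a rank-one projection $|\psi\rangle\langle\psi|$ with $|\psi\rangle$ a unit vector, and $\operatorname{Tr}_A$ is the partial trace over $\mathcal{H}_A$. For $\pi\in S_k$, $W_{B_1\cdots B_k}(\pi)$ is the unitary on $\mathcal{H}_B^{\otimes k}$ permuting the tensor factors: $W_{B_1\cdots B_k}(\pi)(v_1\otimes\cdots\otimes v_k)=v_{\pi^{-1}(1)}\otimes\cdots\otimes v_{\pi^{-1}(k)}$. The generalized algorithm performs a $G$-Bose symmetry test on $\psi_{AB}^{\otimes k}$ with respect to the representation $g\mapsto I_{A_1\cdots A_k}\otimes W_{B_1\cdots B_k}(g)$ of $G\le S_k$; its acceptance probability is $$p_G:=\operatorname{Tr}\Big[\Big(I_{A_1\cdots A_k}\otimes \frac{1}{|G|}\sum_{g\in G}W_{B_1\cdots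 B_k}(g)\Big)\psi_{AB}^{\otimes k}\Big],$$ where $W_{B_1\cdots B_k}(g)$ acts on the $k$ copies of $\mathcal{H}_B$ and $I_{A_1\cdots A_k}$ on the $k$ copies of $\mathcal{H}_A$. The cycle index polynomial of a permutation group $G\le S_k$ is $$Z(G)(x_1,\ldots,x_k):=\frac{1}{|G|}\sum_{g\in G}x_1^{c_1(g)}\cdots x_k^{c_k(g)},$$ where $c_j(g)$ is the number of cycles of length $j$ in the disjoint cycle decomposition of $g$ acting on $\{1,\ldots,k\}$ (fixed points count as cycles of length $1$). *)

(* Defs.v *)
From HB Require Import structures.
From mathcomp Require Import all_boot all_order all_algebra all_fingroup.
From mathcomp Require Import reals complex mxtens mpoly.

Set Implicit Arguments.
Unset Strict Implicit.
Unset Printing Implicit Defensive.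

Import Order.TTheory GRing.Theory Num.Theory.
Local Open Scope ring_scope.
Local Open Scope sesquilinear_scope.

(* A d-dimensional Hilbert space is C^d with its standard inner product; kets
   are column vectors and operators are square matrices. H_A (x) H_B is
   C^(m * n), with the index encoding [mxtens_index] of [mxtens], so that the
   tensor product of operators is [_ *t _]. *)

Section States.
Variable C : numClosedFieldType.

Definition pure_state d (P : 'M[C]_d) : Prop :=
  exists2 v : 'cV[C]_d, v^t* *m v = 1%:M & P = v *m v^t*.

Definition ptraceA m n (M : 'M[C]_(m * n)) : 'M[C]_n :=
  \matrix_(j, j') \sum_(i < m) M (mxtens_index (i, j)) (mxtens_index (i, j')).

Lemma ptraceA_tens m n (X : 'M[C]_m) (Y : 'M[C]_n) :
  ptraceA (X *t Y) = \tr X *: Y.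
Proof.
apply/matrixP=> j j'; rewrite !mxE /mxtrace mulr_suml.
by apply: eq_bigr => i _; rewrite tensmxE.
Qed.

End States.

(* The k-th tensor power of C^d has as its basis the product vectors
   e_(x 1) (x) ... (x) e_(x k), for x : {ffun 'I_k -> 'I_d}; [midx] and [ridx]
   translate between these multi-indices and matrix indices. *)

Notation tdim k d := #|{: {ffun 'I_k -> 'I_d}}|.

Definition midx k d (i : 'I_(tdim k d)) : {ffun 'I_k -> 'I_d} := enum_val i.

Definition ridx k d (x : {ffun 'I_k -> 'I_d}) : 'I_(tdim k d) := enum_rank x.

Lemma ridxK k d : cancel (@ridx k d) (@midx k d).
Proof. exact: enum_rankK. Qed.

Lemma midxK k d : cancel (@midx k d) (@ridx k d).
Proof. exact: enum_valK. Qed.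

Lemma midx_inj k d : injective (@midx k d).
Proof. exact: can_inj (@midxK k d). Qed.

Lemma ridx_inj k d : injective (@ridx k d).
Proof. exact: can_inj (@ridxK k d). Qed.

Section TensorPowers.
Variables (C : numClosedFieldType) (k : nat).

Definition tensv d (v : 'I_k -> 'cV[C]_d) : 'cV[C]_(tdim k d) :=
  \col_i \prod_(t < k) v t (midx i t) 0.

Definition tpow d (M : 'M[C]_d) : 'M[C]_(tdim k d) :=
  \matrix_(i, j) \prod_(t < k) M (midx i t) (midx j t).

(* W(p) maps the basis vector labelled y to the one labelled y \o p^-1. *)
Definition perm_op d (p : 'S_k) : 'M[C]_(tdim k d) :=
  \matrix_(i, j) (midx i == [ffun t => midx j ((p^-1)%g t)])%:R.

Lemma perm_op_tensv d (p : 'S_k) (v : 'I_k -> 'cV[C]_d) :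
  perm_op d p *m tensv v = tensv (fun t => v ((p^-1)%g t)).
Proof.
apply/matrixP=> i z; rewrite !mxE.
pose x := [ffun t => midx i (p t)] : {ffun 'I_k -> 'I_d}.
rewrite (bigD1 (ridx x)) //= big1 => [|j /eqP neq_jx].
  rewrite addr0 !mxE ridxK.
  have -> : midx i == [ffun t => x ((p^-1)%g t)].
    by apply/eqP/ffunP=> t; rewrite !ffunE permKV.
  rewrite mul1r (reindex_inj (@perm_inj _ (p^-1)%g)) /=.
  by apply: eq_bigr => t _; rewrite ffunE permKV.
rewrite !mxE; case: eqP => [Eij|_]; last by rewrite mul0r.
case: neq_jx; apply: midx_inj; rewrite ridxK.
by apply/ffunP=> t; rewrite ffunE Eij ffunE permK.
Qed.

Lemma tpow_outer d (v : 'cV[C]_d) :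
  tpow (v *m v^t*) = tensv (fun=> v) *m (tensv (fun=> v))^t*.
Proof.
apply/matrixP=> i j; rewrite !mxE big_ord1 !mxE rmorph_prod -big_split /=.
by apply: eq_bigr => t _; rewrite !mxE big_ord1 !mxE.
Qed.

(* The factors of the k-th power of H_A (x) H_B come in the order
   A_1 B_1 ... A_k B_k; [split_copies] relabels the basis so as to group them
   as A_1 ... A_k B_1 ... B_k. *)
Definition split_copies m n (i : 'I_(tdim k (m * n))) :
    'I_(tdim k m * tdim k n) :=
  mxtens_index
    (ridx [ffun t => (mxtens_unindex (midx i t)).1],
     ridx [ffun t => (mxtens_unindex (midx i t)).2]).

Lemma split_copies_tensv m n (a : 'I_k -> 'cV[C]_m) (b : 'I_k -> 'cV[C]_n) i :
  tensv (fun t => a t *t b t : 'cV[C]_(m * n)) i 0 =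
  (tensv a *t tensv b : 'cV[C]_(tdim k m * tdim k n)) (split_copies i) 0.
Proof.
rewrite !mxE mxtens_indexK /= !ridxK -big_split.
apply: eq_bigr => t _; rewrite !mxE !ffunE.
by rewrite [(mxtens_unindex (0 : 'I_(1 * 1))).1]ord1
           [(mxtens_unindex (0 : 'I_(1 * 1))).2]ord1.
Qed.

Lemma split_copies_bij m n : bijective (@split_copies m n).
Proof.
have inj : injective (@split_copies m n).
  move=> i j /(can_inj (@mxtens_indexK _ _)) [/ridx_inj E1 /ridx_inj E2].
  apply: midx_inj; apply/ffunP=> t; apply: (can_inj (@mxtens_unindexK m n)).
  move/ffunP/(_ t): E1 => E1t; move/ffunP/(_ t): E2 => E2t.
  rewrite !ffunE in E1t E2t.
  by apply: injective_projections.
apply: inj_card_bij inj _.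
by rewrite !card_ord !card_ffun !card_ord expnMn.
Qed.

Definition tens_copies m n (P : 'M[C]_(tdim k m)) (Q : 'M[C]_(tdim k n)) :
    'M[C]_(tdim k (m * n)) :=
  mxsub (@split_copies m n) (@split_copies m n) (P *t Q).

Definition bose_avg n (G : {group 'S_k}) : 'M[C]_(tdim k n) :=
  #|G|%:R^-1 *: \sum_(g in G) perm_op n g.

Definition accept_prob m n (G : {group 'S_k}) (psi : 'M[C]_(m * n)) : C :=
  \tr (tens_copies (1%:M : 'M[C]_(tdim k m)) (bose_avg n G) *m tpow psi).

End TensorPowers.

Definition ncycles k (g : 'S_k) (j : nat) : nat :=
  #|[set X in porbits g | #|X| == j]|.

(* The variable x_j, for j = 1, ..., k, is 'X_i with j = i.+1. *)
Definition cycle_index (F : fieldType) k (G : {group 'S_k}) : {mpoly F[k]} :=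
  #|G|%:R^-1 *: \sum_(g in G) \prod_(i < k) 'X_i ^+ ncycles g i.+1.

(* Main.v *)
Require Import Defs.
From mathcomp Require Import all_boot all_order all_algebra all_fingroup.
From mathcomp Require Import reals complex mxtens mpoly.

Set Implicit Arguments.
Unset Strict Implicit.
Unset Printing Implicit Defensive.

Import Order.TTheory GRing.Theory Num.Theory.
Local Open Scope ring_scope.

(* Tracing out the copies of H_A turns the term of g in p_G into
   Tr[W(g) rho^(x)k], that is, a sum over all labellings y of the k letters of
   the products of the entries rho (y t) (y (g^-1 t)). Such a product splits
   along the cycles of g^-1, which are those of g, so the sum of products is a
   product over cycles X of sums over labellings of X. Following the cycle, the
   latter is a sum over closed walks of length #|X|, i.e., Tr[rho^#|X|]. *)

(** * Sums over labellings of cycles *)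

Section CycleTrace.
Variable F : comNzRingType.

(** Induction on [l], splitting off the first step: [q] lists the [l] intermediate vertices of a
    walk of [l.+1] steps from [a] to [b]. *)
Lemma expmx_walk n (M : 'M[F]_n) l a b :
  (M ^+ l.+1) a b =
  \sum_(q : l.-tuple 'I_n) \prod_(z <- pairmap M a (rcons q b)) z.
Proof.
elim: l a => [|l IHl] a.
  rewrite (big_pred1 [tuple]) => [|q /=]; last by apply/esym/eqP/tuple0.
  by rewrite /= big_seq1 expr1.
rewrite exprS mxE.
under eq_bigr => c _ do rewrite IHl big_distrr /=.
rewrite pair_big /= (reindex (fun q : l.+1.-tuple 'I_n =>
  (thead q, [tuple of behead q]))) /=.
  by apply: eq_bigr => q _; case/tupleP: q => c q; rewrite /= theadE big_cons.
exists (fun p => cons_tuple p.1 p.2) => [q _|[c q] _] /=.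
  by rewrite [q in RHS]tuple_eta; apply: val_inj.
by rewrite theadE; congr pair; apply: val_inj.
Qed.

(** Brings the product along an orbit into the form of [expmx_walk]; the walk closes up when
    [iter l.+1 s x] is [x]. *)
Lemma prod_traject (T : Type) n (M : 'M[F]_n) (s : T -> T) (y : T -> 'I_n) x l :
  \prod_(t <- traject s x l.+1) M (y t) (y (s t)) =
  \prod_(z <- pairmap M (y x)
      (rcons (map y (traject s (s x) l)) (y (iter l.+1 s x)))) z.
Proof.
elim: l x => [|l IHl] x; first by rewrite /= !big_seq1.
by rewrite trajectS big_cons IHl -iterSr [RHS]big_cons.
Qed.

Variables (T : finType) (n : nat) (M : 'M[F]_n.+1) (s : {perm T}).
Implicit Type y : {ffun T -> 'I_n.+1}.

(* Labellings of the cycle are represented by functions on T that vanish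
   outside of it. *)
Lemma sum_porbit x :
  \sum_(y : {ffun T -> 'I_n.+1} | ord0.-support y \subset porbit s x)
     \prod_(t in porbit s x) M (y t) (y (s t)) = \tr (M ^+ #|porbit s x|).
Proof.
have [l El] : {l | #|porbit s x| = l.+1}.
  exists #|porbit s x|.-1; rewrite prednK //.
  by apply/card_gt0P; exists x; apply: porbit_id.
pose c := traject s x l.+1.
have Eorb : porbit s x =i c by move=> t; rewrite porbit_traject El.
have Uc : uniq c by rewrite /c -El uniq_traject_porbit.
have szc : size c = l.+1 by rewrite size_traject.
have Hiter : iter l.+1 s x = x by rewrite -El iter_porbit.
rewrite El /mxtrace.
under [RHS]eq_bigr => a _ do rewrite expmx_walk.
rewrite pair_big /=.
(* A closed walk is given by its base point and its other vertices. [restr] lays them out along the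
   cycle from [x] on; off the cycle, [index] is out of range and [nth] returns [ord0]. [walk] reads
   the labels back. *)
pose restr (p : 'I_n.+1 * l.-tuple 'I_n.+1) : {ffun T -> 'I_n.+1} :=
  [ffun t => nth ord0 (p.1 :: p.2) (index t c)].
have szmap y : size (map y (traject s (s x) l)) == l.
  by rewrite size_map size_traject.
pose walk y := (y x, Tuple (szmap y)).
have walkE y : (walk y).1 :: (walk y).2 = map y c by [].
have restrK p : walk (restr p) = p.
  case: p => a q.
  suff: (walk (restr (a, q))).1 :: (walk (restr (a, q))).2 = a :: q.
    by case: (walk _) => a' q' /= [-> Eq]; congr pair; apply: val_inj.
  rewrite walkE; apply: (@eq_from_nth _ ord0); rewrite size_map szc.
    by rewrite /= size_tuple.
  by move=> i lt_il; rewrite (nth_map x) ?szc // ffunE index_uniq ?szc //.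
rewrite (reindex_onto restr walk) => [|y /supportP sy].
  apply: eq_big => [p|p _].
    rewrite restrK eqxx andbT; apply/supportP => t; rewrite Eorb ffunE => ntc.
    rewrite nth_default // [leqLHS]/= size_tuple -szc.
    by rewrite leqNgt index_mem.
  (* [c] lists the cycle without repetition, and [Hiter] makes the walk end where it began. *)
  rewrite (eq_bigl (fun t => t \in c)) // -big_uniq //= prod_traject Hiter.
  have := walkE (restr p); rewrite restrK /= => -[<- <-].
  by [].
apply/ffunP => t; rewrite ffunE walkE.
have [tc|ntc] := boolP (t \in c).
  by rewrite (nth_map x) ?index_mem // nth_index.
by rewrite nth_default ?sy ?Eorb // size_map leqNgt index_mem.
Qed.

(** A labelling of [T] amounts to a family of labellings, one for each cycle, and [s] moves no point
    out of its cycle. Distributivity then exchanges sum and product. *)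
Lemma sum_porbits :
  \sum_(y : {ffun T -> 'I_n.+1}) \prod_t M (y t) (y (s t)) =
  \prod_(X in porbits s) \tr (M ^+ #|X|).
Proof.
have memE X t : X \in porbits s -> (t \in X) = (porbit s t == X).
  by case/imsetP => x _ ->; rewrite eq_porbit_mem.
have porbS t : porbit s t \in porbits s by apply: imset_f.
have porb_s t : porbit s (s t) = porbit s t by rewrite -(porbit_perm s 1 t) expg1.
pose w y (X : {set T}) := \prod_(t in X) M (y t) (y (s t)).
have prodE y : \prod_t M (y t) (y (s t)) = \prod_(X in porbits s) w y X.
  rewrite (partition_big (porbit s) (mem (porbits s))) //=.
  by apply: eq_bigr => X PX; apply: eq_bigl => t; rewrite memE.
transitivity (\prod_(X in porbits s)
    \sum_(y : {ffun T -> 'I_n.+1} | ord0.-support y \subset X) w y X); last first.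
  by apply: eq_bigr => _ /imsetP[x _ ->]; apply: sum_porbit.
(* Families are functions on all subsets of [T]; [y0] is their default value at those that are not
   cycles. *)
pose y0 : {ffun T -> 'I_n.+1} := [ffun=> ord0].
rewrite (big_distr_big_dep y0) /=.
(* [split] restricts [y] to each cycle; [glue] evaluates at [t] the member belonging to the cycle of
   [t]. *)
pose split y := [ffun X : {set T} =>
  if X \in porbits s then [ffun t => if t \in X then y t else ord0] else y0].
pose glue (f : {ffun {set T} -> {ffun T -> 'I_n.+1}}) : {ffun T -> 'I_n.+1} :=
  [ffun t => f (porbit s t) t].
have splitK y : glue (split y) = y.
  by apply/ffunP=> t; rewrite !ffunE porbS ffunE porbit_id.
rewrite [RHS](reindex_onto split glue) => [|f /pfamilyP[/supportP f0 fP]].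
  apply: eq_big => [y|y _].
    rewrite splitK eqxx andbT; apply/esym/pfamilyP.
    split=> [|X PX]; first by apply/supportP => X /negPf nPX; rewrite ffunE nPX.
    by rewrite ffunE PX; apply/supportP => t /negPf ntX; rewrite ffunE ntX.
  rewrite prodE; apply: eq_bigr => X PX; apply: eq_bigr => t tX.
  by rewrite !ffunE PX !ffunE !memE // porb_s -memE // tX.
apply/ffunP => X; rewrite ffunE; case: ifPn => [PX|/f0 //].
apply/ffunP => t; rewrite !ffunE; case: ifPn => [|ntX].
  by rewrite memE // => /eqP->.
by have /supportP-> := fP X PX.
Qed.

End CycleTrace.

(** * The acceptance probability as a sum over the group *)

Lemma sum_mxtens_index (V : nmodType) m n (f : 'I_(m * n) -> V) :
  \sum_z f z = \sum_i \sum_j f (mxtens_index (i, j)).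
Proof.
rewrite pair_big (reindex (@mxtens_index m n)) /=.
  by apply: eq_bigr => -[].
apply: onW_bij; exists (@mxtens_unindex _ _).
  exact: mxtens_indexK.
exact: mxtens_unindexK.
Qed.

Section AcceptProb.
Variables (C : numClosedFieldType) (k : nat).

(** The identity on the copies of H_A forces equal A-labels in row and column; summing over them
    copy by copy gives one entry of the partial trace per copy. *)
Lemma mxtrace_tens_copies1 m n (Q : 'M[C]_(tdim k n)) (psi : 'M[C]_(m * n)) :
  \tr (tens_copies (1%:M : 'M[C]_(tdim k m)) Q *m tpow k psi) =
  \tr (Q *m tpow k (ptraceA psi)).
Proof.
have [merge splitK mergeK] := @split_copies_bij k m n.
have Emerge i j t : midx (merge (mxtens_index (i, j))) t =
    mxtens_index (midx i t, midx j t).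
  have := mergeK (mxtens_index (i, j)); set z := merge _.
  move=> /(can_inj (@mxtens_indexK _ _)) [<- <-].
  by rewrite !ridxK !ffunE -[LHS]mxtens_unindexK.
pose mg i j := merge (mxtens_index (i, j)).
have sum_mg (f : 'I_(tdim k (m * n)) -> C) :
    \sum_z f z = \sum_i \sum_j f (mg i j).
  rewrite (reindex merge) ?sum_mxtens_index //=.
  by apply: onW_bij; exists (@split_copies k m n).
rewrite /mxtrace sum_mg.
transitivity (\sum_a \sum_i \sum_j Q i j * tpow k psi (mg a j) (mg a i)).
  apply: eq_bigr => a _; apply: eq_bigr => i _.
  rewrite mxE sum_mg (bigD1 a) //= [X in _ + X]big1 => [|b nba].
    rewrite addr0; apply: eq_bigr => j _.
    by rewrite [tens_copies _ _ _ _]mxE !mergeK tensmxE mxE eqxx mul1r.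
  apply: big1 => j _.
  rewrite [tens_copies _ _ _ _]mxE !mergeK tensmxE mxE eq_sym (negPf nba).
  by rewrite !mul0r.
rewrite exchange_big /=.
apply: eq_bigr => i _; rewrite mxE exchange_big; apply: eq_bigr => j _ /=.
rewrite -mulr_sumr; congr (_ * _); rewrite mxE.
under [RHS]eq_bigr => t _ do rewrite mxE.
(* The product over copies of sums over A-indices expands into a sum over multi-indices. *)
rewrite bigA_distr_bigA /= (reindex (@midx k m)) /=; last first.
  by apply: onW_bij; exists (@ridx k m); [apply: midxK | apply: ridxK].
apply: eq_bigr => a _; rewrite mxE; apply: eq_bigr => t _.
by rewrite !Emerge.
Qed.

(** The column of W(p) labelled y has its only nonzero entry in the row labelled y \o p^-1, so the
    cycle sum arises for p^-1, which has the orbits of p. *)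
Lemma mxtrace_perm_op n (p : 'S_k) (M : 'M[C]_n.+1) :
  \tr (perm_op C n.+1 p *m tpow k M) = \prod_(X in porbits p) \tr (M ^+ #|X|).
Proof.
rewrite -porbitsV -sum_porbits /mxtrace.
under eq_bigr => i _ do rewrite mxE.
rewrite exchange_big /= (reindex (@ridx k n.+1)) /=; last first.
  by apply: onW_bij; exists (@midx k n.+1); [apply: ridxK | apply: midxK].
apply: eq_bigr => y _; rewrite (bigD1 (ridx [ffun t => y ((p^-1)%g t)])) //=.
rewrite big1 ?addr0 => [|i]; last first.
  rewrite -(inj_eq (@midx_inj _ _)) ridxK => /negPf ni.
  by rewrite mxE ridxK ni mul0r.
rewrite !mxE !ridxK eqxx mul1r.
by apply: eq_bigr => t _; rewrite ffunE.
Qed.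

Lemma accept_probE m n (G : {group 'S_k}) (psi : 'M[C]_(m * n.+1)) :
  accept_prob G psi = #|G|%:R^-1 *
    \sum_(g in G) \prod_(X in porbits g) \tr (ptraceA psi ^+ #|X|).
Proof.
rewrite /accept_prob mxtrace_tens_copies1 -scalemxAl mxtraceZ mulmx_suml.
rewrite raddf_sum; congr (_ * _); apply: eq_bigr => g _ /=.
exact: mxtrace_perm_op.
Qed.

End AcceptProb.

(** * Normalization and evaluation of the cycle index *)

Lemma mxtrace_ptraceA (C : numClosedFieldType) m n (psi : 'M[C]_(m * n)) :
  \tr (ptraceA psi) = \tr psi.
Proof.
rewrite /mxtrace sum_mxtens_index exchange_big /=.
by apply: eq_bigr => j _; rewrite mxE.
Qed.

Lemma mxtrace_pure_state (C : numClosedFieldType) d (P : 'M[C]_d) :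
  pure_state P -> \tr P = 1.
Proof. by case=> v v1 ->; rewrite mxtrace_mulC v1 mxtrace1. Qed.

(** Each power of x_j is spread over the cycles of length j, one factor for each; the factors are
    then regrouped by cycle. *)
Lemma meval_cycle_index (F : fieldType) k (G : {group 'S_k}) (f : nat -> F) :
  (cycle_index F G).@[fun i => f i.+1] =
  #|G|%:R^-1 * \sum_(g in G) \prod_(X in porbits g) f #|X|.
Proof.
rewrite mevalZ raddf_sum; congr (_ * _); apply: eq_bigr => g _ /=.
rewrite rmorph_prod /=.
transitivity (\prod_(i < k) \prod_(X in porbits g | #|X| == i.+1) f i.+1).
  apply: eq_bigr => i _; rewrite rmorphXn /= mevalXU prodr_const; congr (_ ^+ _).
  by apply: eq_card => X; rewrite !inE.
rewrite (exchange_big_dep (mem (porbits g))) /=; last by move=> i X _ /andP[].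
apply: eq_bigr => X PX.
(* A cycle has between 1 and [k] points, so exactly one variable matches its length, the one with
   index [#|X|.-1]. *)
have [lt0X leXk] : (0 < #|X|)%N /\ (#|X| <= k)%N.
  split; last by rewrite -[leqRHS]card_ord max_card.
  by case/imsetP: PX => x _ ->; apply/card_gt0P; exists x; apply: porbit_id.
have ltXk : (#|X|.-1 < k)%N by rewrite prednK.
rewrite (big_pred1 (Ordinal ltXk)) /= ?prednK // => i /=.
by rewrite PX -val_eqE /= -[in LHS](prednK lt0X) eqSS eq_sym.
Qed.

(** The partial trace preserves the trace and a pure state has trace one, so the value 1 of x_1
    agrees with Tr[rho] and both forms hold. *)
Theorem theorem4p1 (R : realType) (m n k : nat)
    (gT : finGroupType) (G : {group gT}) (phi : {morphism G >-> 'S_k})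
    (psi : 'M[R[i]]_(m * n)) :
  ('injm phi)%g -> pure_state psi ->
  let rho := ptraceA psi in
  let GS := (phi @* G)%G in
  accept_prob GS psi =
    (cycle_index R[i] GS).@[fun i : 'I_k =>
       if i == 0%N :> nat then 1 else \tr (rho ^+ i.+1)]
  /\
  accept_prob GS psi =
    (cycle_index R[i] GS).@[fun i : 'I_k => \tr (rho ^+ i.+1)].
Proof.
move=> _ psi_pure rho GS.
have tr_rho : \tr rho = 1.
  by rewrite mxtrace_ptraceA; apply: mxtrace_pure_state.
have accE : accept_prob GS psi =
    (cycle_index R[i] GS).@[fun i : 'I_k => \tr (rho ^+ i.+1)].
  rewrite (meval_cycle_index GS (fun j => \tr (rho ^+ j))).
  (* The default label [ord0] requires H_B of nonzero dimension; in dimension zero [tr_rho] would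
     read 0 = 1. *)
  case: n psi psi_pure @rho tr_rho => [|n] psi psi_pure rho tr_rho.
    by move/eqP: tr_rho; rewrite /mxtrace big_ord0 eq_sym oner_eq0.
  exact: accept_probE.
split=> //; rewrite accE; apply: meval_eq => i /=.
by case: eqP => // ->; rewrite expr1.
Qed.
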